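(* Let $f,g_1,\dots,g_m\in\mathbb{R}[\mathbf{x}]$ and $\mathbf{X}=\{\mathbf{x}\in\mathbb{R}^n:g_j(\mathbf{x})\ge0,\ j\in[m]\}$. Suppose $I_1,\dots,I_p\subseteq[n]$ with $\bigcup_kI_k=[n]$ and a partition of $[m]$ into pairwise disjoint $J_1,\dots,J_p$ satisfy: (i) $f=f_1+\dots+f_p$ with $f_k\in\mathbb{R}[\mathbf{x}(I_k)]$; (ii) $g_j\in\mathbb{R}[\mathbf{x}(I_k)]$ for all $k\in[p]$ and $j\in J_k$; (iii) $I_1,\dots,I_p$ satisfy the running intersection property; (iv) for each $k\in[p]$ there is $N_k>0$ such that $N_k-\sum_{i\in I_k}x_i^2$ is one of the $g_j$, $j\in J_k$. Let $\mathbf{R}$ be a binary matrix whose columns are the sign symmetries of $\mathscr{A}=\operatorname{supp}(f)\cup\bigcup_{j=1}^m\operatorname{supp}(g_j)$. If $f$ is positive on $\mathbf{X}$, then $$f=\sum_{k=1}^p\Big(\sigma_{k,0}+\sum_{j\in J_k}\sigma_{k,j}g_j\Big)$$ for some sums of squares $\sigma_{k,j}\in\Sigma[\mathbf{x}(I_k)]$, $j\in\{0\}\cup J_k$, $k\in[p]$, satisfying $\mathbf{R}^\intercal\alpha\equiv\mathbf{0}\pmod2$ for every $\alpha\in\operatorname{supp}(\sigma_{k,j})$.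
   Context: $[n]=\{1,\dots,n\}$; $\mathbb{R}[\mathbf{x}(I_k)]$ is the ring of polynomials in the variables $\{x_i\}_{i\in I_k}$ and $\Sigma[\mathbf{x}(I_k)]$ the cone of sums of squares of such polynomials. RIP: for every $k\in[p-1]$ there is $i\le k$ with $I_{k+1}\cap\bigcup_{j\le k}I_j\subseteq I_i$. The sign symmetries of a finite $\mathscr{A}\subseteq\mathbb{N}^n$ are all $\mathbf{s}\in\{0,1\}^n$ with $\mathbf{s}^\intercal\alpha\equiv0\pmod2$ for all $\alpha\in\mathscr{A}$. *)

(* Defs.v *)
From HB Require Import structures.
From mathcomp Require Import all_boot all_order all_algebra.
From mathcomp Require Import reals.
From mathcomp Require Import mpoly.
Set Implicit Arguments. Unset Strict Implicit. Unset Printing Implicit Defensive.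
Import Order.TTheory GRing.Theory Num.Theory.
Local Open Scope ring_scope.

Section Defs.
Variables (R : realType) (n : nat).

Definition mpoly_in (S : {set 'I_n}) (q : {mpoly R[n]}) : Prop :=
  forall a, a \in msupp q -> forall i : 'I_n, i \notin S -> a i = 0%N.

Definition sos_in (S : {set 'I_n}) (q : {mpoly R[n]}) : Prop :=
  exists hs : seq {mpoly R[n]},
    (forall h, h \in hs -> mpoly_in S h) /\ q = \sum_(h <- hs) h ^+ 2.

Definition sign_symmetry (A : seq 'X_{1..n}) (s : 'I_n -> bool) : Prop :=
  forall a, a \in A -> ~~ odd (\sum_(i < n) (s i : nat) * a i)%N.

(* R^T alpha = 0 mod 2, where the columns of R are the sign symmetries of A *)
Definition sym_compatible (A : seq 'X_{1..n}) (alpha : 'X_{1..n}) : Prop :=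
  forall s : 'I_n -> bool, sign_symmetry A s ->
    ~~ odd (\sum_(i < n) (s i : nat) * alpha i)%N.

End Defs.

Definition RIP (n p : nat) (I : 'I_p -> {set 'I_n}) : Prop :=
  forall k k' : 'I_p, nat_of_ord k' = k.+1 ->
    exists i : 'I_p, (i <= k)%N /\
      (I k' :&: \bigcup_(j : 'I_p | (j <= k)%N) I j \subset I i).

(* Main.v *)
(* A lexicographically minimal state on a cone with an order unit is pure.  For
   Q1 + Q2, with Q1, Q2 archimedean quadratic modules in R[x(S)] and R[x(T)],
   purity forces a state to be multiplicative first on R[x(S :&: T)] and then
   on R[x(S)] and R[x(T)]; such a state is evaluation at a point.  So if
   f1 + f2 is positive where Q1 and Q2 are nonnegative, separation gives
   f1 + f2 = e + q1 + q2 with e > 0.  Along the running intersection property,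
   the shared polynomial f2 - q2 = e + q1 - f1 is absorbed in an earlier block,
   and induction yields the sparse representation.  Keeping only the monomials
   invariant under one sign symmetry at a time preserves f and the g_j, and
   turns a square (e + o)^2, with e even and o odd, into e^2 + o^2. *)
Require Import Defs.
From HB Require Import structures.
From mathcomp Require Import all_boot all_order all_algebra.
From mathcomp Require Import reals.
From mathcomp Require Import ssrcomplements mpoly.
From mathcomp Require boolp classical_sets.
From mathcomp Require Import ring lra.
Set Implicit Arguments.
Unset Strict Implicit.
Unset Printing Implicit Defensive.
Import Order.TTheory GRing.Theory Num.Theory.
Local Open Scope ring_scope.

(** * Pure states by lexicographic minimization *)

Section LexicographicState.
Variables (R : realType) (E : lmodType R) (u : E).
Implicit Types (Q : E -> Prop) (b v : E).

Definition convex_cone Q :=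
  (forall x y, Q x -> Q y -> Q (x + y)) /\
  (forall c x, 0 <= c -> Q x -> Q (c *: x)).

Definition order_bounded Q b := exists N : R, Q (N *: u - b) /\ Q (N *: u + b).

(** Dually, the infimum at [b] of the functionals nonnegative on [Q] and equal to 1 at [u]; as a
    supremum of lower bounds it needs no functional at hand. *)
Definition cone_inf Q b : R := sup (fun r => Q (b - r *: u)).

(** As [t] has either sign, a functional nonnegative on this cone and equal to 1 at [u] must take
    the value [cone_inf Q b] at [b]: the cone is dual to the face of minimizers. *)
Definition adjoin_line Q b v :=
  exists q t, Q q /\ v = q + t *: (b - cone_inf Q b *: u).

Section Step.
Variables (Q : E -> Prop) (b : E).
Hypotheses (cQ : convex_cone Q) (Qu : Q u) (Qpr : ~ Q (- u)).
Hypothesis (ob : order_bounded Q b).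

Let Qconst (c : R) : Q (c *: u) -> 0 <= c.
Proof.
move=> Qc; rewrite leNgt; apply/negP => c0; apply: Qpr.
have -> : - u = (- c^-1) *: (c *: u).
  by rewrite scalerA mulNr mulVf ?lt_eqF // scaleN1r.
by apply: cQ.2 => //; rewrite oppr_ge0 invr_le0 ltW.
Qed.

Let has_sup_b : classical_sets.has_sup (fun r => Q (b - r *: u)).
Proof.
have [N [QN1 QN2]] := ob; split.
  by exists (- N); rewrite /= scaleNr opprK addrC.
exists N => r Qr; rewrite -subr_ge0; apply: Qconst.
have -> : (N - r) *: u = (N *: u - b) + (b - r *: u).
  by rewrite addrA subrK scalerBl.
exact: cQ.1.
Qed.

Lemma cone_inf_adherent (e : R) : 0 < e -> Q (b - (cone_inf Q b - e) *: u).
Proof.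
move=> e0; have [r Qr lr] := sup_adherent e0 has_sup_b.
have -> : b - (cone_inf Q b - e) *: u =
    (b - r *: u) + (r - (cone_inf Q b - e)) *: u.
  by rewrite [in RHS]scalerBl addrA subrK.
by apply: cQ.1 => //; apply: cQ.2 => //; rewrite subr_ge0 ltW.
Qed.

Lemma cone_inf_ub r : Q (b - r *: u) -> r <= cone_inf Q b.
Proof. by move=> Qr; apply: ub_le_sup => //; case: has_sup_b. Qed.

Lemma adjoin_line_sub q : Q q -> adjoin_line Q b q.
Proof. by move=> Qq; exists q, 0; rewrite scale0r addr0. Qed.

Lemma adjoin_line_line t : adjoin_line Q b (t *: (b - cone_inf Q b *: u)).
Proof.
exists 0, t; rewrite add0r; split=> //.
by rewrite -(scale0r u); apply: cQ.2.
Qed.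

Lemma adjoin_line_cone : convex_cone (adjoin_line Q b).
Proof.
split=> [x y [q [t [Qq ->]]] [q' [t' [Qq' ->]]] | c x c0 [q [t [Qq ->]]]].
  exists (q + q'), (t + t'); split; first exact: cQ.1.
  by rewrite scalerDl addrACA.
exists (c *: q), (c * t); split; first exact: cQ.2.
by rewrite scalerDr scalerA.
Qed.

(** Suppose [- u = q + t *: (b - c *: u)]. If [t < 0], then [b - (c - t^-1) *: u] lies in [Q], above
    the supremum [c]. If [t > 0], adding [t^-1 *: q] to a member of [Q] close to [b - c *: u] gives
    a negative multiple of [u]. *)
Lemma adjoin_line_proper : ~ adjoin_line Q b (- u).
Proof.
case=> q [t [Qq]]; set c := cone_inf Q b => eq_u.
have [t0|t0|t0] := ltgtP t 0.
- have : c - t^-1 <= c.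
    apply: cone_inf_ub.
    have -> : b - (c - t^-1) *: u = (- t^-1) *: q.
      have -> : q = - u - t *: (b - c *: u) by rewrite eq_u addrK.
      rewrite scalerBl; set d := b - c *: u; rewrite opprB addrA addrAC -/d.
      rewrite scalerBr scalerN scalerA mulNr mulVf ?lt_eqF //.
      by rewrite !scaleNr scale1r !opprK addrC.
    by apply: cQ.2 => //; rewrite oppr_ge0 invr_le0 ltW.
  by rewrite gerBl invr_ge0 leNgt t0.
- have t2 : 0 < t^-1 / 2 by rewrite divr_gt0 ?invr_gt0.
  have Qa := cone_inf_adherent t2; rewrite -/c in Qa.
  have : Q ((- (t^-1 / 2)) *: u).
    have -> : (- (t^-1 / 2)) *: u =
        (b - (c - t^-1 / 2) *: u) + t^-1 *: q.
      have -> : q = - u - t *: (b - c *: u) by rewrite eq_u addrK.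
      rewrite scalerBl; set d := b - c *: u; rewrite opprB addrA addrAC -/d.
      rewrite scalerBr scalerN scalerA mulVf ?gt_eqF // scale1r.
      set h := t^-1 / 2.
      have -> : t^-1 = h + h by rewrite -splitr.
      by rewrite scalerDl opprD [d + _]addrC addrACA subrr addr0 addNKr scaleNr.
    by apply: cQ.1 => //; apply: cQ.2 => //; rewrite invr_ge0 ltW.
  by move/Qconst; rewrite oppr_ge0 leNgt t2.
- by apply: Qpr; rewrite eq_u t0 scale0r addr0.
Qed.

End Step.

Section Limit.
Variables (Q : E -> Prop) (b : nat -> E).
Hypotheses (cQ : convex_cone Q) (Qu : Q u) (Qpr : ~ Q (- u)).
Hypothesis (ob : forall i, order_bounded Q (b i)).

Fixpoint lex_cone i : E -> Prop :=
  if i is j.+1 then adjoin_line (lex_cone j) (b j) else Q.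

Let lexc i := cone_inf (lex_cone i) (b i).

Let lex_cone_spec i : [/\ convex_cone (lex_cone i), lex_cone i u,
  ~ lex_cone i (- u), forall q, Q q -> lex_cone i q
  & forall j, order_bounded (lex_cone i) (b j)].
Proof.
elim: i => [|i [ci ui pi si oi]]; first by split.
have sub q : lex_cone i q -> lex_cone i.+1 q by apply: adjoin_line_sub.
split; [exact: adjoin_line_cone | exact: sub | exact: adjoin_line_proper | |].
  by move=> q /si /sub.
by move=> j; have [N [N1 N2]] := oi j; exists N; split; apply: sub.
Qed.

Let lex_cone_mono i j v : (i <= j)%N -> lex_cone i v -> lex_cone j v.
Proof.
move=> /subnKC <-; elim: (j - i)%N => [|k IH]; first by rewrite addn0.
by move=> /IH H; rewrite addnS; apply: adjoin_line_sub.
Qed.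

(* The limit cone is that of a pure state: [c i] minimizes the value at [b i]
   among the states having the values [c j] at [b j] for [j < i], and a
   lexicographic minimizer is an extreme point. *)
Lemma lexicographic_state : exists (c : nat -> R) (Z : E -> Prop),
  [/\ convex_cone Z /\ ~ Z (- u),
      forall q, Q q -> Z q,
      forall i t, Z (t *: (b i - c i *: u)),
      (forall e : R, 0 < e -> ~ Q (b 0%N - e *: u)) -> c 0%N <= 0
    & forall phi psi : {linear E -> R^o},
        (forall q, Q q -> 0 <= phi q) -> (forall q, Q q -> 0 <= psi q) ->
        (forall i, phi (b i) + psi (b i) = c i * (phi u + psi u)) ->
        forall i, phi (b i) = c i * phi u].
Proof.
exists lexc, (fun v => exists i, lex_cone i v); split.
- split; last by case=> i; have [] := lex_cone_spec i.
  split=> [x y [i xi] [j yj]|c x c0 [i xi]].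
    exists (maxn i j); have [[+ _] _ _ _ _] := lex_cone_spec (maxn i j).
    by apply; [apply: lex_cone_mono xi|apply: lex_cone_mono yj];
      rewrite ?leq_maxl ?leq_maxr.
  by exists i; have [[_ +] _ _ _ _] := lex_cone_spec i; apply.
- by move=> q Qq; exists 0%N.
- move=> i t; exists i.+1; have [ci ui pi si oi] := lex_cone_spec i.
  exact: adjoin_line_line.
- move=> nQ; rewrite leNgt; apply/negP => c0.
  have c2 : 0 < lexc 0%N / 2 by rewrite divr_gt0.
  apply: (nQ _ c2); have -> : lexc 0%N / 2 = lexc 0%N - lexc 0%N / 2.
    by rewrite {2}[lexc _]splitr addrK.
  exact: (cone_inf_adherent cQ Qu Qpr (ob 0%N) c2).
- move=> phi psi phi0 psi0 sum.
  (* A functional nonnegative on stage [i] is at least [lexc i * f u] at [b i]. The sum of [phi] and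
     [psi] attains this bound, so each of them does, and both stay nonnegative on the next stage. *)
  have key (f : {linear E -> R^o}) i :
      (forall v, lex_cone i v -> 0 <= f v) -> 0 <= f (b i) - lexc i * f u.
    have [ci ui pi si oi] := lex_cone_spec i => f0.
    have fu : 0 <= f u by apply: f0.
    apply/ler_addgt0Pr => e e0.
    (* The added 1 covers the case [f u = 0]. *)
    have e1 : 0 < e / (f u + 1) by rewrite divr_gt0 // ltr_wpDl.
    have := f0 _ (cone_inf_adherent ci ui pi (oi i) e1).
    rewrite linearB linearZ /= -[_ *: _]/(_ * _) mulrBl.
    have : e / (f u + 1) * f u <= e.
      by rewrite mulrAC ler_pdivrMr ?ltr_wpDl // ler_pM2l // lerDl.
    rewrite -/(lexc i); lra.
  have pos i : (forall v, lex_cone i v -> 0 <= phi v) /\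
               (forall v, lex_cone i v -> 0 <= psi v).
    elim: i => [|i [IH1 IH2]]; first by [].
    have h1 := key _ _ IH1; have h2 := key _ _ IH2; have h3 := sum i.
    split=> v [q [t [Qq ->]]]; rewrite linearD linearZ linearB linearZ /=.
      rewrite -[_ *: phi u]/(_ * _) -[_ *: (_ - _)]/(_ * _).
      have -> : phi (b i) - lexc i * phi u = 0 by lra.
      by rewrite mulr0 addr0 IH1.
    rewrite -[_ *: psi u]/(_ * _) -[_ *: (_ - _)]/(_ * _).
    have -> : psi (b i) - lexc i * psi u = 0 by lra.
    by rewrite mulr0 addr0 IH2.
  move=> i; have [/(key _ _) h1 /(key _ _) h2] := pos i.
  have h3 := sum i; lra.
Qed.

End Limit.
End LexicographicState.

(** * Polynomials in a subset of the variables *)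

Section MonomialMaps.
Variables (R : realType) (n : nat).
Implicit Types (p q : {mpoly R[n]}) (P : pred 'X_{1..n}).

Section Linear.
Variables (V : lmodType R) (F : 'X_{1..n} -> V).

Definition mlin p : V := \sum_(m <- msupp p) p@_m *: F m.

Lemma mlinE p k : (msize p <= k)%N ->
  mlin p = \sum_(m : 'X_{1..n < k}) p@_m *: F m.
Proof.
move=> le_pk; rewrite /mlin (big_mksub 'X_{1..n < k}) ?msupp_uniq //=.
  by rewrite big_rmcond //= => j /memN_msupp_eq0 ->; rewrite scale0r.
by move=> x /msize_mdeg_lt /leq_trans; apply.
Qed.

Lemma mlin_is_linear : linear mlin.
Proof.
move=> c p q; pose k := maxn (msize (c *: p + q)) (maxn (msize p) (msize q)).
rewrite !(@mlinE _ k) ?leq_max ?leqnn ?orbT // scaler_sumr -big_split /=.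
by apply: eq_bigr => m _; rewrite mcoeffD mcoeffZ scalerDl scalerA.
Qed.

HB.instance Definition _ :=
  GRing.isLinear.Build R {mpoly R[n]} V _ mlin mlin_is_linear.

End Linear.

(** Serves twice: with [monom_in S] it projects onto the polynomials in the variables of [S], and
    with a parity onto the invariants of a sign symmetry. *)
Definition restr P : {mpoly R[n]} -> {mpoly R[n]} :=
  mlin (fun m => (P m)%:R *: 'X_[m]).

HB.instance Definition _ P := GRing.Linear.on (restr P).

Lemma mcoeff_restr P p m : (restr P p)@_m = (P m)%:R * p@_m.
Proof.
rewrite /restr /mlin linear_sum /=.
rewrite (eq_bigr (fun m' => (P m)%:R * (p@_m' * (m' == m)%:R))); last first.
  move=> m' _; rewrite !mcoeffZ mcoeffX; case: eqP => [->|_].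
    by rewrite mulrCA.
  by rewrite !mulr0.
rewrite -mulr_sumr; congr (_ * _); rewrite [in RHS](mpolyE p) linear_sum /=.
by apply: eq_bigr => m' _; rewrite mcoeffZ mcoeffX.
Qed.

Lemma msupp_restr P p m : (m \in msupp (restr P p)) = P m && (m \in msupp p).
Proof.
rewrite !mcoeff_msupp mcoeff_restr.
by case: (P m); rewrite ?mul1r // mul0r eqxx.
Qed.

Lemma restr_id P p : (forall m, m \in msupp p -> P m) -> restr P p = p.
Proof.
move=> Pp; apply/mpolyP => m; rewrite mcoeff_restr.
by have [/Pp ->|/memN_msupp_eq0 ->] := boolP (m \in msupp p);
  rewrite ?mul1r ?mulr0.
Qed.

Lemma restr_eq0 P p : (forall m, m \in msupp p -> ~~ P m) -> restr P p = 0.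
Proof.
move=> Pp; apply/mpolyP => m; rewrite mcoeff_restr mcoeff0.
by have [/Pp/negbTE ->|/memN_msupp_eq0 ->] := boolP (m \in msupp p);
  rewrite ?mul0r ?mulr0.
Qed.

End MonomialMaps.

Section SubRing.
Variables (R : realType) (n : nat).
Implicit Types (p q : {mpoly R[n]}) (S T : {set 'I_n}).

Definition monom_in S (m : 'X_{1..n}) := [forall i, (i \notin S) ==> (m i == 0%N)].

Lemma mpoly_inP S p :
  mpoly_in S p <-> (forall m, m \in msupp p -> monom_in S m).
Proof.
split=> [Sp m /Sp Sm|Sp m /Sp /forallP Sm i iS].
  by apply/forallP => i; apply/implyP => /Sm ->.
by have := Sm i; rewrite iS => /eqP.
Qed.

Lemma mpoly_inC S (c : R) : mpoly_in S c%:MP.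
Proof.
by move=> m; rewrite msuppC; case: ifP => // _; rewrite inE => /eqP -> i _;
  rewrite mnm0E.
Qed.

Lemma mpoly_in0 S : mpoly_in S (0 : {mpoly R[n]}).
Proof. by rewrite -mpolyC0; apply: mpoly_inC. Qed.

Lemma mpoly_in1 S : mpoly_in S (1 : {mpoly R[n]}).
Proof. by rewrite -mpolyC1; apply: mpoly_inC. Qed.

Lemma mpoly_inX S i : i \in S -> mpoly_in S ('X_i : {mpoly R[n]}).
Proof.
move=> iS m; rewrite msuppX inE => /eqP -> j jS; rewrite mnm1E.
by case: eqP => // ij; rewrite -ij iS in jS.
Qed.

Lemma mpoly_inD S p q : mpoly_in S p -> mpoly_in S q -> mpoly_in S (p + q).
Proof. by move=> Sp Sq m /msuppD_le; rewrite mem_cat => /orP[/Sp|/Sq]. Qed.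

Lemma mpoly_inM S p q : mpoly_in S p -> mpoly_in S q -> mpoly_in S (p * q).
Proof.
move=> Sp Sq m /msuppM_le /allpairsP[[a b] [/Sp Sa /Sq Sb ->]] i iS /=.
by rewrite mnmDE Sa ?Sb.
Qed.

Lemma mpoly_inZ S (c : R) p : mpoly_in S p -> mpoly_in S (c *: p).
Proof. by move=> Sp m /msuppZ_le /Sp. Qed.

Lemma mpoly_inN S p : mpoly_in S p -> mpoly_in S (- p).
Proof. by rewrite -scaleN1r; apply: mpoly_inZ. Qed.

Lemma mpoly_inB S p q : mpoly_in S p -> mpoly_in S q -> mpoly_in S (p - q).
Proof. by move=> Sp /mpoly_inN; apply: mpoly_inD. Qed.

Lemma mpoly_inXn S p k : mpoly_in S p -> mpoly_in S (p ^+ k).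
Proof.
move=> Sp; elim: k => [|k IH]; first by rewrite expr0; apply: mpoly_in1.
by rewrite exprS; apply: mpoly_inM.
Qed.

Lemma mpoly_in_sum S (I : Type) (r : seq I) (P : pred I) F :
  (forall i, P i -> mpoly_in S (F i : {mpoly R[n]})) ->
  mpoly_in S (\sum_(i <- r | P i) F i).
Proof.
by move=> SF; elim/big_ind: _ => //; [apply: mpoly_in0 | apply: mpoly_inD].
Qed.

Lemma mpoly_in_sub S T p : S \subset T -> mpoly_in S p -> mpoly_in T p.
Proof.
move=> /subsetP ST Sp m /Sp Sm i iT; apply: Sm.
by apply: contra iT => /ST.
Qed.

Lemma mpoly_inI S T p : mpoly_in S p -> mpoly_in T p -> mpoly_in (S :&: T) p.
Proof.
move=> Sp Tp m mp i; rewrite inE negb_and => /orP[] iS.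
  exact: Sp iS.
exact: Tp iS.
Qed.

Lemma mpoly_in_ind (G : {mpoly R[n]} -> Prop) S :
  (forall c : R, G c%:MP) -> (forall i, i \in S -> G 'X_i) ->
  (forall p q, G p -> G q -> G (p + q)) ->
  (forall p q, G p -> G q -> G (p * q)) ->
  forall p, mpoly_in S p -> G p.
Proof.
move=> GC GX GD GM p Sp; rewrite (mpolyE p) big_seq.
have G0 : G 0 by rewrite -mpolyC0.
have G1 : G 1 by rewrite -mpolyC1.
apply: (big_ind G) => // m /Sp Sm; rewrite -mul_mpolyC; apply: (GM) => //.
rewrite mpolyXE_id; apply: (big_ind G) => [//|x y|i _]; first exact: GM.
have [iS|/Sm ->] := boolP (i \in S); last by rewrite expr0.
elim: (m i) => [|k IH]; rewrite ?expr0 // exprS.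
by apply: (GM) => //; apply: GX.
Qed.

End SubRing.

(** * Archimedean quadratic modules *)

Section QuadraticModule.
Variables (R : realType) (n : nat).
Implicit Types (S T : {set 'I_n}) (p q h : {mpoly R[n]}) (Q : {mpoly R[n]} -> Prop).

Definition qmodule S Q :=
  [/\ forall q, Q q -> mpoly_in S q, Q 1, forall p q, Q p -> Q q -> Q (p + q)
    & forall h q, mpoly_in S h -> Q q -> Q (h ^+ 2 * q)].

(** An upper bound is enough: for [- a] it becomes a lower bound. *)
Definition archimedean Q S :=
  forall a, mpoly_in S a -> exists N : R, Q (N%:MP - a).

Lemma qmodule_sqr S Q h : qmodule S Q -> mpoly_in S h -> Q (h ^+ 2).
Proof. by case=> _ Q1 _ QM Sh; rewrite -[_ ^+ 2]mulr1; apply: QM. Qed.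

Lemma qmoduleZ S Q (c : R) q : qmodule S Q -> 0 <= c -> Q q -> Q (c *: q).
Proof.
case=> _ _ _ QM c0 Qq.
have -> : c *: q = (Num.sqrt c)%:MP ^+ 2 * q.
  by rewrite -mul_mpolyC -rmorphXn /= sqr_sqrtr.
by apply: QM => //; apply: mpoly_inC.
Qed.

Lemma qmoduleC S Q (c : R) : qmodule S Q -> 0 <= c -> Q c%:MP.
Proof. by move=> mQ c0; rewrite -alg_mpolyC; apply: (qmoduleZ mQ) => //; case: mQ. Qed.

Lemma archimedean_ge0 S Q a : qmodule S Q -> archimedean Q S ->
  mpoly_in S a -> exists2 N : R, 0 < N & Q (N%:MP - a).
Proof.
(* [N] may fail to be positive; [N ^+ 2 + 1] is positive and exceeds it. *)
move=> mQ aQ /aQ [N QN]; exists (N ^+ 2 + 1); first by rewrite ltr_wpDl ?sqr_ge0.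
have -> : (N ^+ 2 + 1)%:MP - a = (N ^+ 2 + 1 - N)%:MP + (N%:MP - a).
  by rewrite !rmorphB /=; ring.
have [_ _ QD _] := mQ; apply: QD => //; apply: (qmoduleC mQ); nra.
Qed.

(** * Positive functionals and multiplication by bounded squares *)

Section Moment.
Variables (S : {set 'I_n}) (Q : {mpoly R[n]} -> Prop).
Hypotheses (mQ : qmodule S Q) (aQ : archimedean Q S).
Variable L : {linear {mpoly R[n]} -> R^o}.
Hypothesis L0 : forall q, Q q -> 0 <= L q.

Let QS : forall q, Q q -> mpoly_in S q. Proof. by case: mQ. Qed.
Let Q1 : Q 1. Proof. by case: mQ. Qed.
Let QD : forall p q, Q p -> Q q -> Q (p + q). Proof. by case: mQ. Qed.
Let QM : forall h q, mpoly_in S h -> Q q -> Q (h ^+ 2 * q). Proof. by case: mQ. Qed.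

(* [q * (1 - h ^+ 2)] need not belong to [Q]; but Bernoulli's inequality
   [y ^+ m >= 1 + m (y - 1)] for [y = h ^+ 2] holds up to squares, and
   [y ^+ m * q] stays bounded, so [L (q * (1 - y))] is at least [O(1 / m)]. *)
Lemma moment_le1 h q : mpoly_in S h -> Q (1 - h ^+ 2) -> Q q -> L (h ^+ 2 * q) <= L q.
Proof.
move=> Sh Qh Qq.
have [C C0 QC] := archimedean_ge0 mQ aQ (QS Qq).
have Qpow m : Q (1 - (h ^+ m) ^+ 2).
  elim: m => [|m IH].
    by rewrite expr0 expr1n subrr; apply: (qmoduleC (c := 0) mQ).
  have -> : 1 - (h ^+ m.+1) ^+ 2 = h ^+ 2 * (1 - (h ^+ m) ^+ 2) + (1 - h ^+ 2).
    by rewrite [h ^+ m.+1]exprS; ring.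
  by apply: QD => //; apply: QM.
have Qber m : Q (((h ^+ m) ^+ 2 - 1 - m%:R *: (h ^+ 2 - 1)) * q).
  elim: m => [|m IH].
    rewrite expr0 expr1n subrr scale0r subr0 mul0r.
    exact: (qmoduleC (c := 0) mQ).
  have -> : ((h ^+ m.+1) ^+ 2 - 1 - m.+1%:R *: (h ^+ 2 - 1)) * q =
    h ^+ 2 * (((h ^+ m) ^+ 2 - 1 - m%:R *: (h ^+ 2 - 1)) * q) +
    m%:R *: ((h ^+ 2 - 1) ^+ 2 * q).
    by rewrite -!mul_mpolyC -natr1 rmorphD /= mpolyC1 [h ^+ m.+1]exprS; ring.
  apply: QD; first exact: QM.
  apply: (qmoduleZ mQ) => //; apply: QM => //.
  by apply: mpoly_inB; [apply: mpoly_inXn | apply: mpoly_in1].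
(* With [y = h ^+ 2], the first two terms sum to [C - y ^+ m * q], and the Bernoulli term replaces
   [y ^+ m] by its linear bound. A negative [L ((1 - y) * q)] is then refuted by a large [m]. *)
have Qm m : Q (C%:MP - q + m%:R *: ((1 - h ^+ 2) * q)).
  have -> : C%:MP - q + m%:R *: ((1 - h ^+ 2) * q) =
    (h ^+ m) ^+ 2 * (C%:MP - q) + C *: (1 - (h ^+ m) ^+ 2) +
    ((h ^+ m) ^+ 2 - 1 - m%:R *: (h ^+ 2 - 1)) * q.
    by rewrite -!mul_mpolyC; ring.
  apply: QD => //; apply: QD.
    by apply: QM => //; apply: mpoly_inXn.
  by apply: (qmoduleZ mQ) => //; apply: ltW.
rewrite leNgt; apply/negP => lt; set K := L (C%:MP - q).
have d0 : 0 < L (h ^+ 2 * q) - L q by rewrite subr_gt0.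
have [m lt_m] : exists m : nat, K / (L (h ^+ 2 * q) - L q) < m%:R.
  exists (Num.bound (K / (L (h ^+ 2 * q) - L q))).
  by apply: archi_boundP; apply: divr_ge0; [apply: L0 | apply: ltW].
have := L0 (Qm m); rewrite linearD linearZ mulrBl mul1r linearB /= -/K.
rewrite -[_ *: _]/(_ * _); move: lt_m; rewrite ltr_pdivrMr //; lra.
Qed.

(** Dividing [h] by the square root of [N] reduces to the bound 1. *)
Lemma moment_le (N : R) h q : mpoly_in S h -> 0 < N -> Q (N%:MP - h ^+ 2) -> Q q ->
  L (h ^+ 2 * q) <= N * L q.
Proof.
move=> Sh N0 Qh Qq; pose k := (Num.sqrt N)^-1 *: h.
have k2 : k ^+ 2 = N^-1 *: h ^+ 2 by rewrite exprZn exprVn sqr_sqrtr // ltW.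
have : L (k ^+ 2 * q) <= L q.
  apply: moment_le1 => //; first exact: mpoly_inZ.
  have -> : 1 - k ^+ 2 = N^-1 *: (N%:MP - h ^+ 2).
    rewrite scalerBr k2 -[N%:MP]mulr1 mul_mpolyC scalerA mulVf ?gt_eqF //.
    by rewrite scale1r.
  by apply: (qmoduleZ mQ) => //; rewrite invr_ge0 ltW.
by rewrite k2 -scalerAl linearZ /= -[_ *: _]/(_ * _) ler_pdivrMl.
Qed.

End Moment.
End QuadraticModule.

(** * The two-block theorem *)

Section PureState.
Variables (R : realType) (n : nat).
Variables (D : pred 'X_{1..n}) (Q : {mpoly R[n]} -> Prop) (f : {mpoly R[n]}).

(** The state is pure on the span of the monomials in [D], for two blocks the sum of their
    polynomial rings; the order unit 1 is assumed to dominate only there. *)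
Definition supported (p : {mpoly R[n]}) := forall m : 'X_{1..n}, m \in msupp p -> D m.

Hypotheses (D0 : D 0%MM) (QD : forall q, Q q -> supported q) (Df : supported f).
Hypotheses (cQ : convex_cone Q) (Q1 : Q 1).
Hypothesis (aQ : forall v : {mpoly R[n]}, supported v -> exists N : R, Q (N%:MP - v)).
Hypothesis (nQ : forall e : R, 0 < e -> ~ Q (f - e%:MP)).

Lemma pure_state : exists L : {linear {mpoly R[n]} -> R^o},
  [/\ L 1 = 1, forall q, Q q -> 0 <= L q, L f <= 0 &
     forall phi : {linear {mpoly R[n]} -> R^o},
       (forall q, Q q -> 0 <= phi q <= L q) ->
       forall v, supported v -> phi v = phi 1 * L v].
Proof.
have supp0 : supported 0 by move=> m; rewrite msupp0.
have supp1 : supported 1 by move=> m; rewrite msupp1 inE => /eqP ->.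
have suppZ (c : R) v : supported v -> supported (c *: v).
  by move=> Dv m /msuppZ_le /Dv.
have suppX m : D m -> supported 'X_[m].
  by move=> Dm m'; rewrite msuppX inE => /eqP ->.
(* Putting [f] first makes its value the first to be minimized, whence [L f <= 0]. The monomials in
   [D] follow by their codes; 0 fills the other codes. *)
pose b i : {mpoly R[n]} := if i is j.+1 then
  if @unpickle 'X_{1..n} j is Some m then if D m then 'X_[m] else 0 else 0 else f.
have Db i : supported (b i).
  by case: i => [|j] //=; case: unpickle => [m|//]; case: ifP => // /suppX.
have bX m : D m -> b (pickle m).+1 = 'X_[m] by move=> Dm; rewrite /= pickleK Dm.
(* If [Q] contained [- 1], it would contain all constants; as it contains some [f + N], it would
   contain [f - 1]. *)
have Qpr : ~ Q (- 1).
  have [N] := aQ (suppZ (-1) _ Df); rewrite scaleN1r opprK addrC => QN Qm1.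
  apply: (nQ ltr01).
  have Qc (c : R) : Q c%:MP.
    rewrite -alg_mpolyC; have [c0|/ltW c0] := leP 0 c; first exact: cQ.2.
    by rewrite -[c]opprK scaleNr -scalerN; apply: cQ.2; rewrite ?oppr_ge0.
  have -> : f - 1%:MP = (f + N%:MP) + (- N - 1)%:MP.
    by rewrite rmorphB rmorphN /=; ring.
  exact: cQ.1.
have ob i : order_bounded 1 Q (b i).
  have [N1 QN1] := aQ (Db i).
  have [N2] := aQ (suppZ (-1) _ (Db i)); rewrite scaleN1r opprK => QN2.
  have le (N : R) M v : N <= M -> Q (N%:MP + v) -> Q (M *: 1 + v).
    move=> NM QN; have -> : M *: 1 + v = (M - N) *: 1 + (N%:MP + v).
      by rewrite !alg_mpolyC rmorphB /=; ring.
    by apply: cQ.1 => //; apply: cQ.2; rewrite ?subr_ge0.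
  exists (Num.max N1 N2); split.
    by apply: le QN1; rewrite le_max lexx.
  by apply: le QN2; rewrite le_max lexx orbT.
have [c [Z [[cZ Zpr] QZ bZ c0 ext]]] := lexicographic_state cQ Q1 Qpr ob.
have Zge0 (r : R) : Z r%:MP -> 0 <= r.
  move=> Zr; rewrite leNgt; apply/negP => r0; apply: Zpr.
  have -> : -1 = (- r^-1) *: r%:MP :> {mpoly R[n]}.
    by rewrite -alg_mpolyC scalerA mulNr mulVf ?lt_eqF // scaleN1r.
  by apply: cZ.2 => //; rewrite oppr_ge0 invr_le0 ltW.
have [L LE] : exists L : {linear {mpoly R[n]} -> R^o},
    forall v, L v = \sum_(m <- msupp v) v@_m * c (pickle m).+1.
  by exists (mlin (fun m : 'X_{1..n} => c (pickle m).+1 : R^o)).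
(* Modulo the lines contained in [Z], a supported [v] is the constant [L v]; as [Z] contains no
   negative constant, that constant is unique. *)
have LZ v : supported v -> forall t : R, Z (t *: (v - (L v)%:MP)).
  move=> Dv t.
  have -> : t *: (v - (L v)%:MP) =
      \sum_(m <- msupp v) (t * v@_m) *: ('X_[m] - c (pickle m).+1 *: 1).
    rewrite {1}(mpolyE v) LE rmorph_sum /= -sumrB scaler_sumr.
    apply: eq_bigr => m _.
    rewrite -!mul_mpolyC !rmorphM /= mulr1.
    by rewrite -mulrBr mulrA.
  rewrite big_seq; apply: (big_ind Z) => [||m /Dv /bX <-].
  - by apply: QZ; rewrite -(scale0r 1); apply: cQ.2.
  - exact: cZ.1.
  - exact: bZ.
have Luniq v (r : R) : supported v -> (forall t : R, Z (t *: (v - r%:MP))) -> L v = r.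
  move=> Dv Zr; apply/eqP; rewrite eq_le; apply/andP.
  split; rewrite -subr_ge0; apply: Zge0.
    have -> : (r - L v)%:MP = 1 *: (v - (L v)%:MP) + (-1) *: (v - r%:MP).
      by rewrite rmorphB /= scale1r scaleN1r; ring.
    by apply: cZ.1; [apply: LZ|apply: Zr].
  have -> : (L v - r)%:MP = 1 *: (v - r%:MP) + (-1) *: (v - (L v)%:MP).
    by rewrite rmorphB /= scale1r scaleN1r; ring.
  by apply: cZ.1; [apply: Zr|apply: LZ].
have L1 : L 1 = 1.
  apply: Luniq => // t; rewrite mpolyC1 subrr scaler0.
  by apply: QZ; rewrite -(scale0r 1); apply: cQ.2.
have Lb i : L (b i) = c i.
  by apply: Luniq => // t; rewrite -alg_mpolyC; apply: bZ.
have L0 q : Q q -> 0 <= L q.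
  move=> Qq; apply: Zge0.
  have -> : (L q)%:MP = q + (-1) *: (q - (L q)%:MP) by rewrite scaleN1r; ring.
  by apply: cZ.1; [apply: QZ | apply: LZ; apply: QD].
exists L; split=> //.
  rewrite -[f]/(b 0%N) Lb; apply: c0 => e e0.
  by rewrite alg_mpolyC; apply: nQ.
move=> phi phiL v Dv.
have phib i : phi (b i) = c i * phi 1.
  (* Extremality is applied to the splitting of [L] into the positive functionals [phi] and
     [L - phi]. *)
  apply: (ext phi (L \- phi)) => [q /phiL /andP[]//|q /phiL /andP[_]|j] /=.
    by rewrite subr_ge0.
  by rewrite L1 Lb; ring.
rewrite (mpolyE v) !linear_sum mulr_sumr !big_seq; apply: eq_bigr => m /Dv Dm.
rewrite !linearZ /= -bX // phib Lb -![_ *: _]/(_ * _); ring.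
Qed.

End PureState.

(** * Multiplicativity of a pure state on two overlapping blocks *)

Section PureStateOnTwoBlocks.
Variables (R : realType) (n : nat) (L : {linear {mpoly R[n]} -> R^o}).

(** Purity for the cone [Q1 + Q2], tested on each summand: a form symmetric in the two blocks, so
    that results for [S] transfer to [T]. *)
Definition block_pure (S T : {set 'I_n}) (Q1 Q2 : {mpoly R[n]} -> Prop) :=
  forall phi : {linear {mpoly R[n]} -> R^o},
    (forall q, Q1 q -> 0 <= phi q <= L q) -> (forall q, Q2 q -> 0 <= phi q <= L q) ->
    forall v, mpoly_in S v \/ mpoly_in T v -> phi v = phi 1 * L v.

Variables (S T : {set 'I_n}) (Q1 Q2 : {mpoly R[n]} -> Prop).
Hypotheses (mQ1 : qmodule S Q1) (mQ2 : qmodule T Q2).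
Hypotheses (aQ1 : archimedean Q1 S) (aQ2 : archimedean Q2 T).
Hypotheses (L1 : L 1 = 1) (LQ1 : forall q, Q1 q -> 0 <= L q).
Hypothesis (LQ2 : forall q, Q2 q -> 0 <= L q).
Hypothesis pureL : block_pure S T Q1 Q2.

Let linear_functional (f : {mpoly R[n]} -> R) :
  linear (f : {mpoly R[n]} -> R^o) ->
  exists phi : {linear {mpoly R[n]} -> R^o}, forall v, phi v = f v.
Proof.
move=> lf; pose flM := GRing.isLinear.Build R {mpoly R[n]} R^o *:%R f lf.
pose fl : {linear {mpoly R[n]} -> R^o} := HB.pack f flM.
by exists fl.
Qed.

Let scaleRE (x y : R) : x *: (y : R^o) = x * y. Proof. by []. Qed.

Let square_bound (U : {set 'I_n}) Q (M N : R) h q :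
  qmodule U Q -> archimedean Q U -> (forall p, Q p -> 0 <= L p) ->
  mpoly_in U h -> 0 < M -> M <= N -> Q (M%:MP - h ^+ 2) -> Q q ->
  0 <= N^-1 * L (h ^+ 2 * q) <= L q.
Proof.
move=> mQ aQ LQ Uh M0 MN QM Qq; have N0 := lt_le_trans M0 MN.
apply/andP; split.
  apply: mulr_ge0; first by rewrite invr_ge0 ltW.
  by apply: LQ; case: mQ => _ _ _; apply.
rewrite ler_pdivrMl //; apply: le_trans (moment_le mQ aQ LQ Uh M0 QM Qq) _.
by apply: ler_wpM2r => //; apply: LQ.
Qed.

(** Positivity controls only squares; [4 b = (b + 1)^2 - (b - 1)^2] passes from them to all
    elements. *)
Let polarization (G : {mpoly R[n]} -> Prop) v :
  G 1 -> (forall p q, G p -> G q -> G (p + q)) ->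
  (forall p q, G p -> G q -> G (p - q)) ->
  (forall h, G h -> L (h ^+ 2 * v) = L (h ^+ 2) * L v) ->
  forall b, G b -> L (b * v) = L b * L v.
Proof.
move=> G1 GD GB sq b Gb.
have -> : b = (4%:R)^-1 *: ((b + 1) ^+ 2 - (b - 1) ^+ 2).
  have -> : (b + 1) ^+ 2 - (b - 1) ^+ 2 = 4%:R *: b.
    by rewrite scaler_nat; ring.
  by rewrite scalerA mulVf ?scale1r // pnatr_eq0.
rewrite -scalerAl !linearZ mulrBl !linearB /=.
rewrite !sq; [|exact: GB|exact: GD].
by rewrite !scaleRE; ring.
Qed.

(* Multiplication by a square of the overlap ring scales [L] up to a bounded
   positive functional, so purity makes it a scalar. *)
Lemma pure_mult_overlap b v : mpoly_in S b -> mpoly_in T b ->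
  mpoly_in S v \/ mpoly_in T v -> L (b * v) = L b * L v.
Proof.
move=> Sb Tb STv.
apply: (@polarization (fun p => mpoly_in S p /\ mpoly_in T p)) => //.
- by split; apply: mpoly_in1.
- by move=> p q [Sp Tp] [Sq Tq]; split; apply: mpoly_inD.
- by move=> p q [Sp Tp] [Sq Tq]; split; apply: mpoly_inB.
move=> h [Sh Th].
have [N1 N1_0 QN1] := archimedean_ge0 mQ1 aQ1 (mpoly_inXn (k := 2) Sh).
have [N2 N2_0 QN2] := archimedean_ge0 mQ2 aQ2 (mpoly_inXn (k := 2) Th).
(* One scaling constant has to serve both modules. *)
have N0 : 0 < N1 + N2 by apply: addr_gt0.
have [phi phiE] : exists phi : {linear {mpoly R[n]} -> R^o},
    forall p, phi p = (N1 + N2)^-1 * L (h ^+ 2 * p).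
  apply: linear_functional => c p q; rewrite mulrDr -scalerAr linearD linearZ /=.
  by rewrite !scaleRE; ring.
have bnd1 q : Q1 q -> 0 <= phi q <= L q.
  rewrite phiE; apply: (square_bound mQ1 aQ1 LQ1 Sh N1_0 _ QN1).
  by rewrite lerDl ltW.
have bnd2 q : Q2 q -> 0 <= phi q <= L q.
  rewrite phiE; apply: (square_bound mQ2 aQ2 LQ2 Th N2_0 _ QN2).
  by rewrite lerDr ltW.
have := pureL bnd1 bnd2 STv; rewrite !phiE mulr1 -[_ * _ * L v]mulrA.
by apply: mulfI; rewrite invr_eq0 gt_eqF.
Qed.

(** For [h] outside the variables of [T], multiplication by [h ^+ 2] is not controlled on [Q2]. The
    functional [phi] is therefore [L (h ^+ 2 * p)] on block [S] and [L (h ^+ 2) * L p] on block [T],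
    up to the factor [N^-1]; multiplicativity on the overlap makes the two agree there. *)
Lemma pure_mult_block b v : mpoly_in S b -> mpoly_in S v -> L (b * v) = L b * L v.
Proof.
move=> Sb Sv; apply: (@polarization (mpoly_in S)) => //.
- exact: mpoly_in1.
- by move=> p q; apply: mpoly_inD.
- by move=> p q; apply: mpoly_inB.
move=> {b Sb} h Sh; have Sh2 := mpoly_inXn (k := 2) Sh.
have [N N0 QN] := archimedean_ge0 mQ1 aQ1 Sh2.
pose pr := restr (R := R) (monom_in S).
have prS p : mpoly_in S p -> pr p = p by move=> /mpoly_inP; apply: restr_id.
have prST p : mpoly_in T p -> mpoly_in S (pr p) /\ mpoly_in T (pr p).
  move=> Tp; split; first by apply/mpoly_inP => m; rewrite msupp_restr => /andP[].
  by move=> m; rewrite msupp_restr => /andP[_ /Tp].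
(* The projection [pr] glues both prescriptions into one linear formula: it fixes polynomials in [S]
   and sends those in [T] into the overlap. *)
have [phi phiE] : exists phi : {linear {mpoly R[n]} -> R^o},
    forall p, phi p = N^-1 * (L (h ^+ 2 * pr p) + L (h ^+ 2) * L (p - pr p)).
  apply: linear_functional => c p q.
  rewrite (_ : pr (c *: p + q) = c *: pr p + pr q); last exact: linearP.
  rewrite [h ^+ 2 * (_ + _)]mulrDr -scalerAr !linearB !linearD !linearZ /= !scaleRE.
  ring.
have phiS p : mpoly_in S p -> phi p = N^-1 * L (h ^+ 2 * p).
  by move=> Sp; rewrite phiE prS // subrr linear0 mulr0 addr0.
have phiT p : mpoly_in T p -> phi p = N^-1 * L (h ^+ 2) * L p.
  move=> /prST [Sp Tp]; rewrite phiE [_ * pr p]mulrC.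
  by rewrite pure_mult_overlap //; [rewrite linearB /=; ring|left].
have bnd1 q : Q1 q -> 0 <= phi q <= L q.
  move=> Qq; rewrite phiS; last by case: mQ1 => + _ _ _; apply.
  by apply: (square_bound mQ1 aQ1 LQ1 Sh N0 _ QN).
have bnd2 q : Q2 q -> 0 <= phi q <= L q.
  move=> Qq; rewrite phiT; last by case: mQ2 => + _ _ _; apply.
  have Lq := LQ2 Qq; have Lh : 0 <= L (h ^+ 2) by apply/LQ1/(qmodule_sqr mQ1).
  have hN : L (h ^+ 2) <= N.
    have := LQ1 QN; rewrite linearB /= -alg_mpolyC linearZ /= L1 subr_ge0.
    by rewrite scaleRE mulr1.
  rewrite !mulr_ge0 ?invr_ge0 ?(ltW N0) //= ler_piMl //.
  by rewrite ler_pdivrMl // mulr1.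
have := pureL bnd1 bnd2 (or_introl Sv).
rewrite !phiS ?mulr1; [|exact: mpoly_in1|by []].
rewrite -[_ * _ * L v]mulrA; apply: mulfI; by rewrite invr_eq0 gt_eqF.
Qed.

Lemma pure_eval v : mpoly_in S v -> L v = v.@[fun i => L 'X_i].
Proof.
move=> Sv; pose G p := mpoly_in S p /\ L p = p.@[fun i => L 'X_i].
suff [] : G v by [].
apply: (mpoly_in_ind (G := G) _ _ _ _ Sv).
- move=> c; split; first exact: mpoly_inC.
  by rewrite mevalC -alg_mpolyC linearZ /= L1 scaleRE mulr1.
- by move=> i iS; split; [exact: mpoly_inX | rewrite mevalXU].
- move=> p q [Sp Lp] [Sq Lq]; split; first exact: mpoly_inD.
  by rewrite linearD mevalD Lp Lq.
- move=> p q [Sp Lp] [Sq Lq]; split; first exact: mpoly_inM.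
  by rewrite pure_mult_block // mevalM Lp Lq.
Qed.

End PureStateOnTwoBlocks.

Theorem two_block_positivstellensatz (R : realType) (n : nat) (S T : {set 'I_n})
    (Q1 Q2 : {mpoly R[n]} -> Prop) (f1 f2 : {mpoly R[n]}) :
  qmodule S Q1 -> qmodule T Q2 -> archimedean Q1 S -> archimedean Q2 T ->
  mpoly_in S f1 -> mpoly_in T f2 ->
  (forall x, (forall q, Q1 q -> 0 <= q.@[x]) -> (forall q, Q2 q -> 0 <= q.@[x]) ->
     0 < (f1 + f2).@[x]) ->
  exists (e : R) q1 q2, [/\ 0 < e, Q1 q1, Q2 q2 & f1 + f2 = e%:MP + (q1 + q2)].
Proof.
move=> mQ1 mQ2 aQ1 aQ2 Sf1 Tf2 pos; apply: boolp.contrapT => nex.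
pose D m := monom_in S m || monom_in T m.
pose Q q := exists q1 q2, [/\ Q1 q1, Q2 q2 & q = q1 + q2].
have Q10 : Q1 0 by rewrite -mpolyC0; apply: (qmoduleC mQ1).
have Q20 : Q2 0 by rewrite -mpolyC0; apply: (qmoduleC mQ2).
have Q1Q q : Q1 q -> Q q by move=> Qq; exists q, 0; rewrite addr0.
have Q2Q q : Q2 q -> Q q by move=> Qq; exists 0, q; rewrite add0r.
have [Q1S Q11 Q1D _] := mQ1; have [Q2T _ Q2D _] := mQ2.
have suppST p q : mpoly_in S p -> mpoly_in T q -> supported D (p + q).
  move=> /mpoly_inP Sp /mpoly_inP Tq m /msuppD_le; rewrite mem_cat /D.
  by case/orP=> [/Sp ->|/Tq ->]; rewrite ?orbT.
have [|||||||L [L1 LQ Lf pureL]] := @pure_state R n D Q (f1 + f2).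
- by apply/orP; left; apply/forallP => i; rewrite mnm0E implybT.
- by move=> _ [q1 [q2 [/Q1S Sq1 /Q2T Tq2 ->]]]; apply: suppST.
- exact: suppST.
- split=> [_ _ [p1 [p2 [P1 P2 ->]]] [q1 [q2 [P3 P4 ->]]]|c _ c0 [q1 [q2 [P1 P2 ->]]]].
    by exists (p1 + q1), (p2 + q2); split; [apply: Q1D|apply: Q2D|rewrite addrACA].
  exists (c *: q1), (c *: q2); rewrite scalerDr.
  by split=> //; [apply: (qmoduleZ mQ1)|apply: (qmoduleZ mQ2)].
- exact: Q1Q.
(* The monomials of [v] outside [S] lie in [T], so [v] splits into two parts, each bounded in its
   own module. *)
- move=> v Dv; pose v1 := restr (monom_in S) v.
  have Sv1 : mpoly_in S v1.
    by apply/mpoly_inP => m; rewrite msupp_restr => /andP[].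
  have Tv2 : mpoly_in T (v - v1).
    apply/mpoly_inP => m; rewrite mcoeff_msupp mcoeffB mcoeff_restr.
    have [|nS] := boolP (monom_in S m); first by rewrite mul1r subrr eqxx.
    by rewrite mul0r subr0 -mcoeff_msupp => /Dv; rewrite /D (negbTE nS).
  have [N1 QN1] := aQ1 _ Sv1; have [N2 QN2] := aQ2 _ Tv2.
  exists (N1 + N2), (N1%:MP - v1), (N2%:MP - (v - v1)); split=> //.
  by rewrite rmorphD /=; ring.
- move=> e e0 [q1 [q2 [P1 P2 E]]]; apply: nex; exists e, q1, q2; split=> //.
  by rewrite -E addrCA subrr addr0.
have LQ1 q : Q1 q -> 0 <= L q by move=> /Q1Q /LQ.
have LQ2 q : Q2 q -> 0 <= L q by move=> /Q2Q /LQ.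
have pST : block_pure L S T Q1 Q2.
  move=> phi phi1 phi2 v STv; apply: pureL.
    move=> _ [q1 [q2 [/phi1/andP[a1 a2] /phi2/andP[b1 b2] ->]]].
    by rewrite !linearD /= addr_ge0 ?lerD.
  by move=> m mv; case: STv => /mpoly_inP/(_ _ mv); rewrite /D => ->; rewrite ?orbT.
have pTS : block_pure L T S Q2 Q1.
  by move=> phi phi2 phi1 v /or_comm; apply: pST.
have evS := pure_eval mQ1 mQ2 aQ1 aQ2 L1 LQ1 LQ2 pST.
have evT := pure_eval mQ2 mQ1 aQ2 aQ1 L1 LQ2 LQ1 pTS.
(* Both blocks are evaluated at the same point, so [L] of the sum [f1 + f2] is its value there. *)
have := pos (fun i => L 'X_i); rewrite mevalD -evS // -evT // -linearD ltNge Lf.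
move=> /(_ _ _)/negP; apply=> // q Qq.
  by rewrite -evS ?LQ1 //; apply: Q1S.
by rewrite -evT ?LQ2 //; apply: Q2T.
Qed.

(** * Quadratic modules generated by the constraints *)

Section SumsOfSquares.
Variables (R : realType) (n : nat).
Implicit Types (S : {set 'I_n}) (p q h : {mpoly R[n]}).

Lemma sos_in_mpoly_in S q : sos_in S q -> mpoly_in S q.
Proof.
case=> hs [Sh ->]; rewrite big_seq; apply: mpoly_in_sum => h /Sh.
exact: mpoly_inXn.
Qed.

Lemma sos_in_sqr S h : mpoly_in S h -> sos_in S (h ^+ 2).
Proof.
by move=> Sh; exists [:: h]; rewrite big_seq1; split=> // h'; rewrite inE => /eqP ->.
Qed.

Lemma sos_in0 S : sos_in S (0 : {mpoly R[n]}).
Proof. by exists [::]; rewrite big_nil. Qed.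

Lemma sos_in1 S : sos_in S (1 : {mpoly R[n]}).
Proof. by rewrite -(expr1n _ 2); apply/sos_in_sqr/mpoly_in1. Qed.

Lemma sos_inD S p q : sos_in S p -> sos_in S q -> sos_in S (p + q).
Proof.
move=> [hs [Sh ->]] [ks [Sk ->]]; exists (hs ++ ks); rewrite big_cat; split=> // h.
by rewrite mem_cat => /orP[/Sh|/Sk].
Qed.

Lemma sos_in_sqrM S h q : mpoly_in S h -> sos_in S q -> sos_in S (h ^+ 2 * q).
Proof.
move=> Sh [hs [Shs ->]]; exists [seq h * k | k <- hs]; split.
  by move=> _ /mapP[k /Shs Sk ->]; apply: mpoly_inM.
by rewrite big_map mulr_sumr; apply: eq_bigr => k _; rewrite exprMn.
Qed.

Lemma sos_in_ge0 S q x : sos_in S q -> 0 <= q.@[x].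
Proof.
case=> hs [_ ->]; rewrite rmorph_sum /=.
by apply: sumr_ge0 => h _; rewrite rmorphXn sqr_ge0.
Qed.

End SumsOfSquares.

Section GeneratedModule.
Variables (R : realType) (n m : nat) (g : 'I_m -> {mpoly R[n]}).
Implicit Types (S : {set 'I_n}) (J : {set 'I_m}) (p q h : {mpoly R[n]}).

Definition gen_qmodule S J q := exists s0 (s : 'I_m -> {mpoly R[n]}),
  [/\ sos_in S s0, forall j, j \in J -> sos_in S (s j)
    & q = s0 + \sum_(j in J) s j * g j].

Lemma gen_qmodule_qmodule S J : (forall j, j \in J -> mpoly_in S (g j)) ->
  qmodule S (gen_qmodule S J).
Proof.
move=> Sg; split.
- move=> _ [s0 [s [S0 Ss ->]]]; apply: mpoly_inD; first exact: sos_in_mpoly_in.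
  apply: mpoly_in_sum => j jJ; apply: mpoly_inM; last exact: Sg.
  exact/sos_in_mpoly_in/Ss.
- exists 1, (fun=> 0); split=> [|j _|]; [exact: sos_in1 | exact: sos_in0 |].
  by rewrite big1 ?addr0 // => j _; rewrite mul0r.
- move=> _ _ [s0 [s [S0 Ss ->]]] [t0 [t [T0 Tt ->]]].
  exists (s0 + t0), (fun j => s j + t j); split; first exact: sos_inD.
    by move=> j jJ; apply: sos_inD; [apply: Ss | apply: Tt].
  rewrite addrACA -big_split /=; congr (_ + _).
  by apply: eq_bigr => j _; rewrite mulrDl.
- move=> h _ Sh [s0 [s [S0 Ss ->]]].
  exists (h ^+ 2 * s0), (fun j => h ^+ 2 * s j); split; first exact: sos_in_sqrM.
    by move=> j jJ; apply: sos_in_sqrM => //; apply: Ss.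
  by rewrite mulrDr mulr_sumr; congr (_ + _); apply: eq_bigr => j _; rewrite mulrA.
Qed.

Lemma gen_qmodule_gen S J j : j \in J -> gen_qmodule S J (g j).
Proof.
move=> jJ; exists 0, (fun j' => (j' == j)%:R); split; first exact: sos_in0.
  by move=> j' _; case: eqP => _; [exact: sos_in1 | exact: sos_in0].
rewrite add0r (bigD1 j) //= eqxx mul1r big1 ?addr0 //.
by move=> j' /andP[_ /negbTE ->]; rewrite mul0r.
Qed.

Lemma gen_qmodule_ge0 S J q x : (forall j, j \in J -> 0 <= (g j).@[x]) ->
  gen_qmodule S J q -> 0 <= q.@[x].
Proof.
move=> g0 [s0 [s [S0 Ss ->]]].
rewrite mevalD addr_ge0 ?(sos_in_ge0 x S0) //.
rewrite rmorph_sum /=.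
apply: sumr_ge0 => j jJ; rewrite mevalM mulr_ge0 ?g0 //.
exact: sos_in_ge0 (Ss j jJ).
Qed.

End GeneratedModule.

(** * From bounds on the variables to the archimedean property *)

Section Archimedean.
Variables (R : realType) (n : nat) (S : {set 'I_n}) (Q : {mpoly R[n]} -> Prop).
Hypothesis (mQ : qmodule S Q).

(** The polynomials whose square is bounded modulo [Q] form a ring containing the constants and the
    variables in [S]. A bound on [a ^+ 2] bounds [a], since [N + 1 - a = (N - a^2) + (a - 1/2)^2 +
    3/4]. *)
Lemma archimedean_variables :
  (forall i, i \in S -> exists N : R, Q (N%:MP - 'X_i ^+ 2)) -> archimedean Q S.
Proof.
have [QS Q1 QD QM] := mQ; have QC c := @qmoduleC _ _ _ _ c mQ => QX a Sa.
pose G p := mpoly_in S p /\ exists2 N : R, 0 <= N & Q (N%:MP - p ^+ 2).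
have [_ [N N0 QN]] : G a.
  apply: (mpoly_in_ind (G := G) _ _ _ _ Sa).
  - move=> c; split; first exact: mpoly_inC.
    exists (c ^+ 2); first exact: sqr_ge0.
    by rewrite rmorphXn subrr -mpolyC0; apply: QC.
  - move=> i iS; split; first exact: mpoly_inX.
    have [N QN] := QX i iS; exists (N ^+ 2 + 1); first by rewrite addr_ge0 ?sqr_ge0.
    have -> : (N ^+ 2 + 1)%:MP - 'X_i ^+ 2 =
        (N ^+ 2 + 1 - N)%:MP + (N%:MP - 'X_i ^+ 2) :> {mpoly R[n]}.
      by rewrite !rmorphB /=; ring.
    by apply: QD => //; apply: QC; nra.
  - move=> p q [Sp [M M0 QMp]] [Sq [N N0 QNq]]; split; first exact: mpoly_inD.
    exists (2 * M + 2 * N); first by lra.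
    have -> : (2 * M + 2 * N)%:MP - (p + q) ^+ 2 = (M%:MP - p ^+ 2) +
       (M%:MP - p ^+ 2) + (N%:MP - q ^+ 2) + (N%:MP - q ^+ 2) + (p - q) ^+ 2.
      by rewrite rmorphD !rmorphM /=; ring.
    apply: (QD); last by apply: (qmodule_sqr mQ); apply: mpoly_inB.
    by apply: (QD) => //; apply: (QD) => //; apply: (QD).
  - move=> p q [Sp [M M0 QMp]] [Sq [N N0 QNq]]; split; first exact: mpoly_inM.
    exists (M * N); first exact: mulr_ge0.
    have -> : (M * N)%:MP - (p * q) ^+ 2 =
        q ^+ 2 * (M%:MP - p ^+ 2) + M *: (N%:MP - q ^+ 2).
      by rewrite rmorphM /= -mul_mpolyC; ring.
    by apply: QD; [apply: QM | apply: (qmoduleZ mQ)].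
exists (N + 1).
have -> : (N + 1)%:MP - a =
    (N%:MP - a ^+ 2) + ((a - (2^-1)%:MP) ^+ 2 + (3 / 4)%:MP).
  have e : (3 / 4 : R) = 1 - 2^-1 ^+ 2 by lra.
  have e2 : a = (2^-1 : R)%:MP * a + (2^-1 : R)%:MP * a.
    by rewrite -mulrDl -rmorphD /= (_ : 2^-1 + 2^-1 = 1) ?mpolyC1 ?mul1r //; lra.
  rewrite e rmorphD rmorphB rmorphXn /= mpolyC1 {1}e2; ring.
apply: (QD) => //; apply: (QD); last by apply: QC; lra.
by apply: (qmodule_sqr mQ); apply: mpoly_inB => //; apply: mpoly_inC.
Qed.

Lemma qmodule_ball_variable (N : R) i :
  i \in S -> Q (N%:MP - \sum_(k in S) 'X_k ^+ 2) -> Q (N%:MP - 'X_i ^+ 2).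
Proof.
move=> iS QN; have [_ _ QD _] := mQ.
have -> : N%:MP - 'X_i ^+ 2 = (N%:MP - \sum_(k in S) 'X_k ^+ 2) +
    \sum_(k in S | k != i) 'X_k ^+ 2 :> {mpoly R[n]}.
  by rewrite [X in _ = _ - X + _](bigD1 i) //=; ring.
apply: (QD) => //; elim/big_ind: _ => [|//|k /andP[kS _]].
  by rewrite -mpolyC0; apply: (qmoduleC mQ).
by apply: (qmodule_sqr mQ); apply: mpoly_inX.
Qed.

End Archimedean.

(** * Running intersection and parity *)

Section RunningIntersection.
Variables (R : realType) (n m p : nat) (g : 'I_m -> {mpoly R[n]}).
Variables (I : 'I_p -> {set 'I_n}) (J : 'I_p -> {set 'I_m}).
Hypothesis hg : forall k j, j \in J k -> mpoly_in (I k) (g j).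
Hypothesis hRIP : RIP I.
Hypothesis hball : forall k : 'I_p, exists N : R, 0 < N /\
  exists2 j : 'I_m, j \in J k & g j = N%:MP - \sum_(i in I k) 'X_i ^+ 2.

Let block_qmodule k : qmodule (I k) (gen_qmodule g (I k) (J k)).
Proof. by apply: gen_qmodule_qmodule => j; apply: hg. Qed.

Let block_archimedean k : archimedean (gen_qmodule g (I k) (J k)) (I k).
Proof.
apply: archimedean_variables => // i iI.
have [N [_ [j jJ gj]]] := hball k; exists N.
apply: (qmodule_ball_variable (block_qmodule k)) => //.
by rewrite -gj; apply: gen_qmodule_gen.
Qed.

Let union k := \bigcup_(l : 'I_p | (l < k)%N) I l.
Let Junion k := \bigcup_(l : 'I_p | (l < k)%N) J l.

Let sub_union k (l : 'I_p) : (l < k)%N -> I l \subset union k.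
Proof. by move=> lk; apply: (bigcup_sup l). Qed.

Let union_qmodule k : qmodule (union k) (gen_qmodule g (union k) (Junion k)).
Proof.
apply: gen_qmodule_qmodule => j /bigcupP[l lk /hg].
exact/mpoly_in_sub/sub_union.
Qed.

(** A union need not have a ball constraint of its own, but each of its variables is bounded by the
    ball of some block containing it. *)
Let union_archimedean k :
  archimedean (gen_qmodule g (union k) (Junion k)) (union k).
Proof.
apply: archimedean_variables => // i iU; have /bigcupP[l lk iI] := iU.
have [N [_ [j jJ gj]]] := hball l; exists N.
have [_ _ QD _] := union_qmodule k.
have -> : N%:MP - 'X_i ^+ 2 = g j + \sum_(k in I l | k != i) 'X_k ^+ 2 :> {mpoly R[n]}.
  by rewrite gj [X in _ = _ - X + _](bigD1 i) //=; ring.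
apply: (QD); first by apply: gen_qmodule_gen; apply/bigcupP; exists l.
elim/big_ind: _ => [|//|j' /andP[jI _]].
  by rewrite -mpolyC0; apply: (qmoduleC (union_qmodule k)).
apply: (qmodule_sqr (union_qmodule k)); apply: mpoly_inX.
exact: (subsetP (sub_union lk)).
Qed.

(* In the step, the two-block theorem applied to the union of the first [k]
   blocks and to block [k] yields a polynomial [b] in the variables they
   share, by which the two parts of [f] can be made separately nonnegative;
   by the running intersection property, [b] can be absorbed in one block. *)
Lemma sparse_positivstellensatz_prefix k (F : 'I_p -> {mpoly R[n]}) :
  (k <= p)%N -> (forall l, mpoly_in (I l) (F l)) ->
  (forall x, (forall (l : 'I_p) j, (l < k)%N -> j \in J l -> 0 <= (g j).@[x]) ->
     0 < (\sum_(l < p | (l < k)%N) F l).@[x]) ->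
  exists q : 'I_p -> {mpoly R[n]},
    (forall l, gen_qmodule g (I l) (J l) (q l)) /\
    \sum_(l < p | (l < k)%N) F l = \sum_(l < p | (l < k)%N) q l.
Proof.
elim: k F => [|k IH] F kp SF pos.
  (* For [k = 0] the positivity assumption reads [0 < 0]. *)
  have := pos (fun=> 0); rewrite big_pred0 // meval0 ltxx.
  by move=> H; have: false by apply: H.
pose K := Ordinal kp.
have recr (G : 'I_p -> {mpoly R[n]}) : \sum_(l < p | (l < k.+1)%N) G l =
    \sum_(l < p | (l < k)%N) G l + G K.
  rewrite (bigD1 K) //= addrC; congr (_ + _); apply: eq_bigl => l.
  by rewrite ltnS leq_eqVlt -(inj_eq val_inj) /=; case: ltngtP.
have gen0 l : gen_qmodule g (I l) (J l) 0.
  by rewrite -mpolyC0; apply: (qmoduleC (block_qmodule l)).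
have block_ge0 l j x : (forall q, gen_qmodule g (I l) (J l) q -> 0 <= q.@[x]) ->
    j \in J l -> 0 <= (g j).@[x] by move=> H jJ; apply/H/gen_qmodule_gen.
(* The first block has no predecessor; the two-block theorem is applied to it paired with itself,
   with first summand 0. *)
have [k0|k_gt0] := posnP k.
  have empty (G : 'I_p -> {mpoly R[n]}) : \sum_(l < p | (l < k)%N) G l = 0.
    by rewrite big_pred0 // => l; rewrite k0.
  have [x Kx _|e [q1 [q2 [e0 Q1 Q2 E]]]] := two_block_positivstellensatz
    (block_qmodule K) (block_qmodule K) (block_archimedean (k := K))
    (block_archimedean (k := K)) (@mpoly_in0 R n (I K)) (SF K).
    rewrite add0r; have := pos x; rewrite recr empty add0r; apply=> l j lk.
    have -> : l = K by apply: val_inj; apply/eqP; move: lk; rewrite /= k0 ltnS leqn0.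
    exact: block_ge0 Kx.
  have [_ _ QD _] := block_qmodule K.
  exists (fun l => if l == K then e%:MP + (q1 + q2) else 0); split.
    move=> l; case: eqP => // ->; apply: (QD); last exact: QD.
    exact/(qmoduleC (block_qmodule K))/ltW.
  by rewrite !recr !empty eqxx -E !add0r.
have SU : mpoly_in (union k) (\sum_(l < p | (l < k)%N) F l).
  by apply: mpoly_in_sum => l /sub_union lU; apply: mpoly_in_sub lU _.
have [x Ux Kx|e [q1 [q2 [e0 Q1 Q2 E]]]] := two_block_positivstellensatz
    (union_qmodule k) (block_qmodule K) (union_archimedean (k := k))
    (block_archimedean (k := K)) SU (SF K).
  have := pos x; rewrite recr; apply=> l j; rewrite ltnS leq_eqVlt => /orP[/eqP lk|lk] jJ.
    by apply: (block_ge0 K) => //; rewrite (_ : K = l) //; apply: val_inj.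
  by apply: Ux; apply: gen_qmodule_gen; apply/bigcupP; exists l.
(* This form shows that [b] involves only variables of block [K]; the equal form [e + q1] minus the
   earlier summands shows that it involves only variables of the union. *)
pose b := F K - q2.
have bE : \sum_(l < p | (l < k)%N) F l + b = e%:MP + q1.
  by rewrite /b addrA E addrA addrK.
have Kb : mpoly_in (I K) b.
  by apply: mpoly_inB => //; have [H _ _ _] := block_qmodule K; apply: H.
have Ub : mpoly_in (union k) b.
  have -> : b = e%:MP + q1 - \sum_(l < p | (l < k)%N) F l.
    by rewrite -bE addrAC subrr add0r.
  apply: mpoly_inB => //; apply: mpoly_inD; first exact: mpoly_inC.
  by have [H _ _ _] := union_qmodule k; apply: H.
(* Running intersection is stated with [j <= k] for consecutive indices; at [k.-1] this is the
   strict range [l < k]. *)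
have k1p : (k.-1 < p)%N by apply: leq_ltn_trans (leq_pred k) kp.
have [i [ik iI]] := hRIP (k := Ordinal k1p) (k' := K) (esym (prednK k_gt0)).
have ik' : (i < k)%N by move: ik; rewrite /= -ltnS prednK.
have ib : mpoly_in (I i) b.
  apply: mpoly_in_sub iI _; apply: mpoly_inI => //.
  rewrite (eq_bigl (fun l : 'I_p => (l < k)%N)) // => l /=.
  by rewrite -ltnS prednK.
(* Adding [b] to block [i] makes the prefix sum equal to [e + q1], positive where the constraints of
   the prefix hold because [e > 0]; block [K] keeps [q2]. *)
pose F' l := if l == i then F i + b else F l.
have F'E : \sum_(l < p | (l < k)%N) F' l = \sum_(l < p | (l < k)%N) F l + b.
  rewrite (bigD1 i) //= [in RHS](bigD1 i) //= /F' eqxx addrAC; congr (_ + _ + _).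
  by apply: eq_bigr => l /andP[_ /negbTE ->].
have [l|x gx|q [Qq qE]] := IH F' (ltnW kp).
- by rewrite /F'; case: eqP => [->|_]; [apply: mpoly_inD | apply: SF].
- rewrite F'E bE mevalD mevalC; apply: ltr_wpDr => //.
  apply: gen_qmodule_ge0 Q1 => j /bigcupP[l lk jJ].
  exact: gx lk jJ.
exists (fun l => if l == K then q2 else q l); split.
  by move=> l; case: eqP => [->|].
rewrite !recr eqxx [in RHS](eq_bigr q) => [|l lk].
  by rewrite -qE F'E /b -[RHS]addrA subrK.
by case: eqP lk => // ->; rewrite ltnn.
Qed.

End RunningIntersection.

(** * Invariants of one sign symmetry *)

Section Parity.
Variables (R : realType) (n : nat) (s : 'I_n -> bool).
Implicit Types (S : {set 'I_n}) (p q h : {mpoly R[n]}).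

(** Flipping the signs of the variables selected by [s] multiplies the monomial by minus one exactly
    when this is true. *)
Definition parity (m : 'X_{1..n}) := odd (\sum_(i < n) (s i : nat) * m i)%N.

Lemma parityD m1 m2 : parity (m1 + m2)%MM = parity m1 (+) parity m2.
Proof.
rewrite /parity -oddD -big_split /=; congr odd.
by apply: eq_bigr => i _; rewrite mnmDE mulnDr.
Qed.

Definition even_part : {mpoly R[n]} -> {mpoly R[n]} := restr (fun m => ~~ parity m).

HB.instance Definition _ := GRing.Linear.on even_part.

Definition has_parity e p := forall m, m \in msupp p -> parity m = e.

Lemma has_parityM e1 e2 p q :
  has_parity e1 p -> has_parity e2 q -> has_parity (e1 (+) e2) (p * q).
Proof.
by move=> ep eq m /msuppM_le /allpairsP[[a b] [/ep <- /eq <- ->]]; rewrite parityD.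
Qed.

Lemma even_part_id p : has_parity false p -> even_part p = p.
Proof. by move=> ep; apply: restr_id => m /ep ->. Qed.

Lemma even_part0 p : has_parity true p -> even_part p = 0.
Proof. by move=> ep; apply: restr_eq0 => m /ep ->. Qed.

Lemma has_parity_even p : has_parity false (even_part p).
Proof. by move=> m; rewrite msupp_restr => /andP[/negbTE]. Qed.

Lemma has_parity_odd p : has_parity true (p - even_part p).
Proof.
move=> m; rewrite mcoeff_msupp mcoeffB mcoeff_restr.
by case: parity; rewrite //= mul1r subrr eqxx.
Qed.

(** The odd part of [p] times an even [g] is odd and disappears; thus the multipliers can be
    projected while the [g j] stay unchanged. *)
Lemma even_partM p g : has_parity false g -> even_part (p * g) = even_part p * g.
Proof.
move=> eg; rewrite -{1}(subrK (even_part p) p) mulrDl linearD /=.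
rewrite (even_part0 (has_parityM (@has_parity_odd p) eg)) add0r.
exact: even_part_id (has_parityM (@has_parity_even p) eg).
Qed.

(* The cross terms of the square of even part plus odd part are odd. *)
Lemma even_part_sqr h :
  even_part (h ^+ 2) = even_part h ^+ 2 + (h - even_part h) ^+ 2.
Proof.
set e := even_part h; set o := h - e.
have ee : has_parity false e := @has_parity_even h.
have oo : has_parity true o := @has_parity_odd h.
have -> : h ^+ 2 = e * e + o * o + (e * o + e * o) by rewrite /o; ring.
rewrite !linearD /= (even_part0 (has_parityM ee oo)) !addr0.
by rewrite !even_part_id //; [apply: (has_parityM oo oo) | apply: (has_parityM ee ee)].
Qed.

Lemma sos_in_even_part S q : sos_in S q -> sos_in S (even_part q).
Proof.
case=> hs [Sh ->]; rewrite linear_sum big_seq /=.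
elim/big_ind: _ => [||h /Sh {}Sh]; [exact: sos_in0 | exact: sos_inD |].
have Se : mpoly_in S (even_part h).
  by move=> m; rewrite msupp_restr => /andP[_ /Sh].
rewrite even_part_sqr; apply: sos_inD; apply: sos_in_sqr => //.
exact: mpoly_inB.
Qed.

End Parity.

(** * Sparse representation with sign-symmetric multipliers *)

Theorem theorem8p4 (R : realType) (n m p : nat)
  (f : {mpoly R[n]}) (g : 'I_m -> {mpoly R[n]})
  (I : 'I_p -> {set 'I_n}) (J : 'I_p -> {set 'I_m})
  (hIcov : \bigcup_(k < p) I k = [set: 'I_n])
  (hJcov : \bigcup_(k < p) J k = [set: 'I_m])
  (hJdisj : forall k l : 'I_p, k != l -> [disjoint J k & J l])
  (hf : exists fk : 'I_p -> {mpoly R[n]},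
          (forall k, mpoly_in (I k) (fk k)) /\ f = \sum_(k < p) fk k)
  (hg : forall (k : 'I_p) (j : 'I_m), j \in J k -> mpoly_in (I k) (g j))
  (hRIP : RIP I)
  (hball : forall k : 'I_p, exists N : R, 0 < N /\
      exists2 j : 'I_m, j \in J k &
        g j = N%:MP - \sum_(i in I k) 'X_i ^+ 2)
  (hpos : forall x : 'I_n -> R,
      (forall j : 'I_m, 0 <= (g j).@[x]) -> 0 < f.@[x]) :
  let A := msupp f ++ flatten [seq msupp (g j) | j : 'I_m] in
  exists (s0 : 'I_p -> {mpoly R[n]}) (s : 'I_p -> 'I_m -> {mpoly R[n]}),
    [/\ forall k : 'I_p, sos_in (I k) (s0 k) /\
          (forall a, a \in msupp (s0 k) -> sym_compatible A a),
        forall (k : 'I_p) (j : 'I_m), j \in J k ->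
          sos_in (I k) (s k j) /\
          (forall a, a \in msupp (s k j) -> sym_compatible A a)
      & f = \sum_(k < p) (s0 k + \sum_(j in J k) s k j * g j)].
Proof.
move=> A; have [fk [Sfk fE]] := hf.
have allp (F : 'I_p -> {mpoly R[n]}) :
    \sum_(l < p | (l < p)%N) F l = \sum_(l < p) F l.
  by apply: eq_bigl => l; rewrite ltn_ord.
have [|q [Qq qE]] :=
    sparse_positivstellensatz_prefix hg hRIP hball (leqnn p) Sfk.
  move=> x gx; rewrite allp -fE; apply: hpos => j.
  have : j \in \bigcup_(k < p) J k by rewrite hJcov inE.
  by case/bigcupP => k _ jk; apply: (gx k).
rewrite !allp -fE in qE.
have /fin_all_exists[w wP] : forall k : 'I_p,
    exists w : {mpoly R[n]} * ('I_m -> {mpoly R[n]}),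
    [/\ sos_in (I k) w.1, forall j, j \in J k -> sos_in (I k) (w.2 j)
      & q k = w.1 + \sum_(j in J k) w.2 j * g j].
  by move=> k; have [s0 [s H]] := Qq k; exists (s0, s).
(* Encoding symmetries as finite functions lets them be enumerated and treated one after another. *)
pose symmetric (t : {ffun 'I_n -> bool}) := all (fun a => ~~ parity t a) A.
have [s0 [s [S0 Ss sE]]] : exists (s0 : 'I_p -> {mpoly R[n]}) s,
    [/\ forall k, sos_in (I k) (s0 k) /\ forall t, symmetric t -> has_parity t false (s0 k),
        forall k j, j \in J k -> sos_in (I k) (s k j) /\
          forall t, symmetric t -> has_parity t false (s k j)
      & f = \sum_(k < p) (s0 k + \sum_(j in J k) s k j * g j)].
  suff : forall l : seq {ffun 'I_n -> bool}, all symmetric l ->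
      exists (s0 : 'I_p -> {mpoly R[n]}) s,
    [/\ forall k, sos_in (I k) (s0 k) /\ forall t, t \in l -> has_parity t false (s0 k),
        forall k j, j \in J k -> sos_in (I k) (s k j) /\
          forall t, t \in l -> has_parity t false (s k j)
      & f = \sum_(k < p) (s0 k + \sum_(j in J k) s k j * g j)].
    move=> /(_ (enum symmetric)); case; first by apply/allP => t; rewrite mem_enum.
    move=> s0 [s [S0 Ss sE]]; exists s0, s; split=> // [k|k j jJ].
      by have [? par] := S0 k; split=> // t st; apply: par; rewrite mem_enum.
    by have [? par] := Ss k j jJ; split=> // t st; apply: par; rewrite mem_enum.
  elim=> [_|t l IH /andP[st /IH [s0 [s [S0 Ss sE]]]]].
    exists (fun k => (w k).1), (fun k => (w k).2); split=> [k|k j jJ|].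
    - by have [? _ _] := wP k.
    - by have [_ /(_ j jJ) ? _] := wP k.
    - by rewrite qE; apply: eq_bigr => k _; have [_ _] := wP k.
  (* Projection only deletes monomials, so parities secured earlier persist. *)
  have keep p' : (forall t', t' \in l -> has_parity t' false p') ->
      forall t', t' \in t :: l -> has_parity t' false (even_part (R := R) t p').
    move=> par t'; rewrite inE => /orP[/eqP ->|/par {}par]; first exact: has_parity_even.
    by move=> a; rewrite msupp_restr => /andP[_ /par].
  have evA p' : {subset msupp p' <= A} -> has_parity t false (p' : {mpoly R[n]}).
    by move=> sub a /sub /(allP st) /negbTE.
  exists (fun k => even_part t (s0 k)), (fun k j => even_part t (s k j)); split.
  - by move=> k; have [? ?] := S0 k; split; [apply: sos_in_even_part | apply: keep].
  - by move=> k j /Ss [? ?]; split; [apply: sos_in_even_part | apply: keep].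
  (* The supports of [f] and the [g j] lie in [A], hence are even for [t]; projecting the whole
     identity changes only the multipliers. *)
  have <- : even_part t f = f.
    by apply/even_part_id/evA => a; rewrite mem_cat => ->.
  rewrite {1}sE linear_sum; apply: eq_bigr => k _; rewrite linearD linear_sum /=.
  congr (_ + _); apply: eq_bigr => j _; apply/even_partM/evA => a ga.
  rewrite mem_cat; apply/orP; right; apply/flatten_mapP; exists j => //.
  by rewrite mem_enum.
have compat p' : (forall t, symmetric t -> has_parity t false p') ->
    forall a, a \in msupp p' -> sym_compatible A a.
  move=> par a ap u su; pose t := [ffun i => u i].
  have tE b : parity t b = parity u b.
    by congr odd; apply: eq_bigr => i _; rewrite ffunE.
  rewrite -[odd _]/(parity u a) -tE (par t _ a ap) //.
  by apply/allP => b /su; rewrite tE.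
exists s0, s; split=> // [k|k j jJ].
  by have [? par] := S0 k; split=> //; apply: compat.
by have [? par] := Ss k j jJ; split=> //; apply: compat.
Qed.
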